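(* If $0<\lambda<1$ then $$F\Big(\frac14,\frac34;1;\lambda^2\Big)=\sqrt{\frac{1}{1+\lambda}}\;F\Big(\frac12,\frac12;1;\frac{2\lambda}{1+\lambda}\Big).$$
   Context: $F={}_2F_1$ denotes the Gauss hypergeometric function, $F(a,b;c;z)=\sum_{n\ge0}\frac{(a)_n(b)_n}{(c)_n\,n!}z^n$ for $|z|<1$. *)

(* Defs.v *)
From Stdlib Require Import Reals Factorial.
From Coquelicot Require Import Coquelicot.
Open Scope R_scope.

(** Rising factorial (a)_n = a (a + 1) ... (a + n - 1). *)
Fixpoint pochhammer (a : R) (n : nat) : R :=
  match n with
  | O => 1
  | S k => pochhammer a k * (a + INR k)
  end.

(** Gauss hypergeometric function 2F1(a, b; c; z) on the real segment |z| < 1.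
    [PSeries] is total: the value is meaningful where the series converges,
    in particular for |z| < 1 when c is not a non-positive integer. *)
Definition hyp2F1 (a b c z : R) : R :=
  PSeries (fun n => (pochhammer a n * pochhammer b n)
                    / (pochhammer c n * INR (fact n))) z.

(* Main.v *)
Require Import Defs.
From Stdlib Require Import Reals Factorial Lra.
From Coquelicot Require Import Coquelicot.
Open Scope R_scope.

(** Both sides, as functions of [x = lambda], solve the self-adjoint equation
    [(x (1 - x^2) y')' = 3/4 x y] on [0, 1) and equal 1 at 0.  This follows
    from the hypergeometric equation for parameters [(a, 1 - a; 1)], whose
    self-adjoint form is [(z (1 - z) F')' = a (1 - a) F]
    ([is_derive_hyp_flux]): substituting [z = x^2] with [a = 1/4] gives the
    left-hand side ([is_derive_lhs_flux]), and substituting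
    [z = 2 x / (1 + x)] with [a = 1/2] and multiplying by [(1 + x)^(-1/2)]
    gives the right-hand side ([is_derive_rhs_flux]).

    The equation is singular at 0, where the factor [x (1 - x^2)] vanishes.
    This makes the initial value alone determine a differentiable solution:
    the Wronskian of two solutions multiplied by this factor is constant,
    hence zero, so the quotient of the solutions is constant
    ([self_adjoint_solution_unique]).  The division is legitimate because the
    left-hand side is a power series with nonnegative coefficients and
    constant term 1 ([hyp_ge_1]).  Working with the flux [p y'] instead of
    [y''] avoids second derivatives throughout. *)

(** * Uniqueness for a singular self-adjoint equation *)

Lemma null_derivative_eq (h : R -> R) (b : R) :
  0 < b ->
  (forall x, 0 <= x <= b -> ex_derive h x) ->
  (forall x, 0 < x < b -> is_derive h x 0) ->
  h b = h 0.
Proof.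
intros hb hex hd.
destruct (MVT_gen h 0 b (fun _ => 0)) as [c [_ hc]].
- intros x hx; apply hd.
  rewrite Rmin_left, Rmax_right in hx by lra; lra.
- intros x hx; apply continuity_pt_filterlim.
  apply (ex_derive_continuous h); apply hex.
  rewrite Rmin_left, Rmax_right in hx by lra; lra.
- lra.
Qed.

(** By Lagrange's identity [p (f g' - g f')] has derivative zero, and it
    vanishes at 0 because [p] does; so [g / f] has derivative zero. *)
Lemma self_adjoint_solution_unique (p q f f1 g g1 : R -> R) (b : R) :
  0 < b ->
  p 0 = 0 ->
  (forall x, 0 < x <= b -> p x <> 0) ->
  (forall x, 0 <= x <= b -> is_derive f x (f1 x)) ->
  (forall x, 0 <= x <= b -> is_derive g x (g1 x)) ->
  (forall x, 0 <= x <= b -> is_derive (fun t => p t * f1 t) x (q x * f x)) ->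
  (forall x, 0 <= x <= b -> is_derive (fun t => p t * g1 t) x (q x * g x)) ->
  (forall x, 0 <= x <= b -> f x <> 0) ->
  f 0 = g 0 ->
  f b = g b.
Proof.
intros hb p0 pn0 hf hg hpf hpg fn0 h0.
assert (hW : forall x, 0 < x <= b -> g1 x * f x - g x * f1 x = 0).
{ intros x hx.
  pose (W := fun t => f t * (p t * g1 t) - g t * (p t * f1 t)).
  assert (hWd : forall t, 0 <= t <= b -> is_derive W t 0).
  { intros t ht.
    replace 0 with ((f1 t * (p t * g1 t) + f t * (q t * g t))
                    - (g1 t * (p t * f1 t) + g t * (q t * f t))) by ring.
    apply @is_derive_minus.
    - apply (is_derive_mult f (fun t => p t * g1 t));
        auto using Rmult_comm.
    - apply (is_derive_mult g (fun t => p t * f1 t));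
        auto using Rmult_comm. }
  assert (hWx : W x = W 0).
  { apply null_derivative_eq; [lra| |].
    - intros t ht; exists 0; apply hWd; lra.
    - intros t ht; apply hWd; lra. }
  unfold W in hWx; rewrite p0 in hWx.
  apply (Rmult_eq_reg_l (p x)); [lra | apply pn0; lra]. }
assert (hq : forall x, 0 <= x <= b ->
  is_derive (fun t => g t / f t) x ((g1 x * f x - g x * f1 x) / f x ^ 2)).
{ intros x hx; apply is_derive_div; auto. }
assert (hgf : g b / f b = g 0 / f 0).
{ apply (null_derivative_eq (fun t => g t / f t)); [assumption| |].
  - intros x hx; eexists; apply hq; exact hx.
  - intros x hx.
    replace 0 with ((g1 x * f x - g x * f1 x) / f x ^ 2).
    + apply hq; lra.
    + rewrite hW by lra; unfold Rdiv; ring. }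
assert (hfb : f b <> 0) by (apply fn0; lra).
rewrite <- h0, Rdiv_diag in hgf by (apply fn0; lra).
apply (Rmult_eq_compat_r (f b)) in hgf.
field_simplify in hgf; lra.
Qed.

(** * The hypergeometric series with parameters (a, 1 - a; 1) *)

Definition hyp_coef (a : R) (n : nat) : R :=
  pochhammer a n * pochhammer (1 - a) n / (pochhammer 1 n * INR (fact n)).

Definition hyp (a : R) : R -> R := PSeries (hyp_coef a).

Definition hyp' (a : R) : R -> R := PSeries (PS_derive (hyp_coef a)).

Lemma pochhammer_1 (n : nat) : pochhammer 1 n = INR (fact n).
Proof.
induction n as [|n IH]; [reflexivity|].
rewrite fact_simpl, mult_INR, S_INR; simpl; rewrite IH; ring.
Qed.

Lemma hyp_coef_0 (a : R) : hyp_coef a 0 = 1.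
Proof. unfold hyp_coef; simpl; field. Qed.

Lemma hyp_coef_S (a : R) (n : nat) :
  INR (S n) * INR (S n) * hyp_coef a (S n)
  = (a + INR n) * (1 - a + INR n) * hyp_coef a n.
Proof.
unfold hyp_coef; rewrite !pochhammer_1, fact_simpl, mult_INR.
cbn [pochhammer]; field.
split; [apply INR_fact_neq_0 | apply not_0_INR; discriminate].
Qed.

(** The ratio of consecutive coefficients is at most 1 because
    [(n + a) (n + 1 - a) <= (n + 1)^2]. *)
Lemma hyp_coef_bounds (a : R) (n : nat) :
  0 < a < 1 -> 0 <= hyp_coef a n <= 1.
Proof.
intros ha; induction n as [|n IH].
- rewrite hyp_coef_0; lra.
- assert (hn : 0 <= INR n) by apply pos_INR.
  assert (h := hyp_coef_S a n); rewrite S_INR in h.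
  assert (hpos : 0 < (INR n + 1) * (INR n + 1)) by nra.
  assert (hlo : 0 <= (a + INR n) * (1 - a + INR n)) by nra.
  assert (hhi : (a + INR n) * (1 - a + INR n) <= (INR n + 1) * (INR n + 1))
    by nra.
  split; apply (Rmult_le_reg_l ((INR n + 1) * (INR n + 1))); nra.
Qed.

Lemma hyp_CV_radius (a x : R) :
  0 < a < 1 -> 0 <= x < 1 -> Rbar_lt (Rabs x) (CV_radius (hyp_coef a)).
Proof.
intros ha hx; apply Rbar_lt_le_trans with 1.
- simpl; rewrite Rabs_pos_eq; lra.
- apply (proj1 (CV_radius_bounded (hyp_coef a))).
  exists 1; intros n; rewrite pow1, Rmult_1_r.
  assert (h := hyp_coef_bounds a n ha); rewrite Rabs_pos_eq; lra.
Qed.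

Lemma is_derive_hyp (a x : R) :
  0 < a < 1 -> 0 <= x < 1 -> is_derive (hyp a) x (hyp' a x).
Proof. intros ha hx; apply is_derive_PSeries, hyp_CV_radius; assumption. Qed.

Lemma hyp_at_0 (a : R) : hyp a 0 = 1.
Proof. unfold hyp; rewrite PSeries_0; apply hyp_coef_0. Qed.

Lemma hyp_ge_1 (a x : R) : 0 < a < 1 -> 0 <= x < 1 -> 1 <= hyp a x.
Proof.
intros ha hx; unfold hyp.
assert (hcv := CV_radius_inside _ _ (hyp_CV_radius a x ha hx)).
unfold PSeries; rewrite Series_incr_1
  by (apply ex_pseries_R; exact hcv).
rewrite hyp_coef_0.
assert (h : 0 <= Series (fun k => hyp_coef a (S k) * x ^ S k)).
{ rewrite <- (Rmult_0_l (Series (fun k => hyp_coef a (S k) * x ^ S k))).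
  rewrite <- Series_scal_l.
  apply Series_le.
  - intros n; assert (h := hyp_coef_bounds a (S n) ha).
    assert (h' : 0 <= x ^ S n) by (apply pow_le; lra).
    split; nra.
  - apply (ex_series_incr_1 (fun k => hyp_coef a k * x ^ k)).
    apply ex_pseries_R; exact hcv. }
simpl; simpl in h; lra.
Qed.

(** With [u = hyp_coef a], the series [x F'] has coefficients [n u_n], and
    the flux is [x F' - x (x F')].  Its derivative has coefficients
    [(n + 1)^2 u_(n+1) - (n + 1) n u_n], which the recurrence [hyp_coef_S]
    turns into [a (1 - a) u_n]. *)
Lemma is_derive_hyp_flux (a x : R) :
  0 < a < 1 -> 0 <= x < 1 ->
  is_derive (fun t => t * (1 - t) * hyp' a t) x (a * (1 - a) * hyp a x).
Proof.
intros ha hx.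
pose (e := PS_incr_1 (PS_derive (hyp_coef a))).
assert (hr : Rbar_lt (Rabs x) (CV_radius e)).
{ unfold e; rewrite CV_radius_incr_1, CV_radius_derive.
  apply hyp_CV_radius; assumption. }
assert (hr' : Rbar_lt (Rabs x) (CV_radius (PS_incr_1 e)))
  by (rewrite CV_radius_incr_1; exact hr).
apply (is_derive_ext (fun t => PSeries e t - PSeries (PS_incr_1 e) t)).
{ intros t; rewrite PSeries_incr_1; unfold e; rewrite PSeries_incr_1.
  unfold hyp'; simpl; ring. }
replace (a * (1 - a) * hyp a x)
  with (PSeries (PS_derive e) x - PSeries (PS_derive (PS_incr_1 e)) x).
{ apply @is_derive_minus; apply is_derive_PSeries; assumption. }
rewrite <- PSeries_minus
  by (apply CV_radius_inside; rewrite CV_radius_derive; assumption).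
unfold hyp; rewrite <- PSeries_scal; apply PSeries_ext; intros n.
change (INR (S n) * (INR (S n) * hyp_coef a (S n)) - INR (S n) * e n
        = a * (1 - a) * hyp_coef a n).
assert (he : e n = INR n * hyp_coef a n).
{ destruct n; [simpl; unfold zero; simpl; ring | reflexivity]. }
rewrite he, <- Rmult_assoc, hyp_coef_S, S_INR; ring.
Qed.

(** * The two sides as solutions of the same equation *)

Lemma is_derive_lhs (x : R) :
  0 <= x < 1 ->
  is_derive (fun t => hyp (1 / 4) (t ^ 2)) x (2 * x * hyp' (1 / 4) (x ^ 2)).
Proof.
intros hx.
apply (is_derive_comp (hyp (1 / 4)) (fun t => t ^ 2)).
- apply is_derive_hyp; nra.
- auto_derive; [trivial | ring].
Qed.

Lemma is_derive_lhs_flux (x : R) :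
  0 <= x < 1 ->
  is_derive (fun t => t * (1 - t ^ 2) * (2 * t * hyp' (1 / 4) (t ^ 2))) x
    (3 / 4 * x * hyp (1 / 4) (x ^ 2)).
Proof.
intros hx.
pose (H := fun z => z * (1 - z) * hyp' (1 / 4) z).
apply (is_derive_ext (fun t => 2 * H (t ^ 2))).
{ intros t; unfold H; simpl; ring. }
replace (3 / 4 * x * hyp (1 / 4) (x ^ 2))
  with (2 * ((2 * x) * (1 / 4 * (1 - 1 / 4) * hyp (1 / 4) (x ^ 2))))
  by field.
apply is_derive_scal.
apply (is_derive_comp H (fun t => t ^ 2)).
- apply is_derive_hyp_flux; nra.
- auto_derive; [trivial | ring].
Qed.

Lemma rhs_argument_bounds (x : R) :
  0 <= x < 1 -> 0 <= 2 * x / (1 + x) < 1.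
Proof.
intros hx; split.
- apply Rdiv_le_0_compat; lra.
- apply Rlt_div_l; lra.
Qed.

Lemma is_derive_rhs_argument (x : R) :
  0 <= x -> is_derive (fun t => 2 * t / (1 + t)) x (2 / (1 + x) ^ 2).
Proof. intros hx; auto_derive; [lra | field; lra]. Qed.

Definition prefactor (x : R) : R := sqrt (1 / (1 + x)).

Lemma is_derive_prefactor (x : R) :
  0 <= x -> is_derive prefactor x (- prefactor x / (2 * (1 + x))).
Proof.
intros hx; unfold prefactor.
assert (hpos : 0 < 1 / (1 + x)) by (apply Rdiv_lt_0_compat; lra).
assert (hs : 0 < sqrt (1 / (1 + x))) by (apply sqrt_lt_R0; exact hpos).
assert (hs2 : sqrt (1 / (1 + x)) * sqrt (1 / (1 + x)) = 1 / (1 + x))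
  by (apply sqrt_sqrt; lra).
replace (- sqrt (1 / (1 + x)) / (2 * (1 + x)))
  with (- (1 / (1 + x) ^ 2) / (2 * sqrt (1 / (1 + x)))).
- apply (is_derive_sqrt (fun t => 1 / (1 + t))); [|exact hpos].
  auto_derive; [lra | field; lra].
- apply (Rmult_eq_reg_r (2 * sqrt (1 / (1 + x)))); [|lra].
  transitivity (- (1 / (1 + x)) / (1 + x)); [field; lra|].
  rewrite <- hs2 at 1; field; lra.
Qed.

Definition rhs (x : R) : R :=
  prefactor x * hyp (1 / 2) (2 * x / (1 + x)).

Definition rhs' (x : R) : R :=
  - prefactor x / (2 * (1 + x)) * hyp (1 / 2) (2 * x / (1 + x))
  + prefactor x * (2 / (1 + x) ^ 2 * hyp' (1 / 2) (2 * x / (1 + x))).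

Lemma is_derive_rhs (x : R) : 0 <= x < 1 -> is_derive rhs x (rhs' x).
Proof.
intros hx.
apply (is_derive_mult prefactor (fun t => hyp (1 / 2) (2 * t / (1 + t))));
  [apply is_derive_prefactor; lra | | exact Rmult_comm].
apply (is_derive_comp (hyp (1 / 2)) (fun t => 2 * t / (1 + t))).
- apply is_derive_hyp; [lra | apply rhs_argument_bounds; exact hx].
- apply is_derive_rhs_argument; lra.
Qed.

(** Write [s = (1 + x)^(-1/2)], [z = 2 x / (1 + x)] and [H = z (1 - z) F'].
    Since [z (1 - z) = 2 x (1 - x) / (1 + x)^2], the flux of [s F(z)] is
    [- x (1 - x) / 2 s F(z) + (1 + x) s H(z)], where [F] and [H] have known
    derivatives.  The two terms in [F'] cancel, and those in [F] add up to
    [3/4 x s F(z)]. *)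
Lemma is_derive_rhs_flux (x : R) :
  0 <= x < 1 ->
  is_derive (fun t => t * (1 - t ^ 2) * rhs' t) x (3 / 4 * x * rhs x).
Proof.
intros hx.
pose (z := fun t => 2 * t / (1 + t)).
pose (H := fun u => u * (1 - u) * hyp' (1 / 2) u).
pose (k := fun t => (1 + t) * prefactor t).
apply (is_derive_ext_loc
         (fun t => - (t * (1 - t) / 2) * rhs t + k t * H (z t))).
{ (* The identity needs [1 + t <> 0], which holds near [x >= 0]. *)
  exists (mkposreal 1 Rlt_0_1); intros t ht.
  change (Rabs (t - x) < 1) in ht; apply Rabs_def2 in ht.
  unfold k, H, rhs, rhs', z; simpl; field; lra. }
replace (3 / 4 * x * rhs x)
  with ((- ((1 - 2 * x) / 2) * rhs x + - (x * (1 - x) / 2) * rhs' x)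
        + (prefactor x / 2 * H (z x)
           + k x * (2 / (1 + x) ^ 2
                    * (1 / 2 * (1 - 1 / 2) * hyp (1 / 2) (z x))))).
2: { unfold k, H, rhs, rhs', z; field; lra. }
apply @is_derive_plus.
- apply (is_derive_mult (fun t => - (t * (1 - t) / 2)) rhs);
    [| apply is_derive_rhs; exact hx | exact Rmult_comm].
  auto_derive; [trivial | field].
- apply (is_derive_mult k (fun t => H (z t))); [| | exact Rmult_comm].
  + replace (prefactor x / 2)
      with (1 * prefactor x
            + (1 + x) * (- prefactor x / (2 * (1 + x)))) by (field; lra).
    apply (is_derive_mult (fun t => 1 + t) prefactor);
      [| apply is_derive_prefactor; lra | exact Rmult_comm].
    auto_derive; [trivial | ring].
  + apply (is_derive_comp H z).
    * apply is_derive_hyp_flux; [lra | apply rhs_argument_bounds; exact hx].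
    * apply is_derive_rhs_argument; lra.
Qed.

Lemma hyp2F1_hyp (a b x : R) : b = 1 - a -> hyp2F1 a b 1 x = hyp a x.
Proof. intros ->; reflexivity. Qed.

Theorem mainTheorem10 (lambda : R) (hlambda : 0 < lambda < 1) :
  hyp2F1 (1 / 4) (3 / 4) 1 (lambda ^ 2)
  = sqrt (1 / (1 + lambda))
    * hyp2F1 (1 / 2) (1 / 2) 1 (2 * lambda / (1 + lambda)).
Proof.
rewrite !hyp2F1_hyp by field.
change (hyp (1 / 4) (lambda ^ 2) = rhs lambda).
apply (self_adjoint_solution_unique
         (fun x => x * (1 - x ^ 2)) (fun x => 3 / 4 * x)
         (fun x => hyp (1 / 4) (x ^ 2))
         (fun x => 2 * x * hyp' (1 / 4) (x ^ 2)) rhs rhs').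
- lra.
- ring.
- intros x hx; apply Rmult_integral_contrapositive; split; nra.
- intros x hx; apply is_derive_lhs; lra.
- intros x hx; apply is_derive_rhs; lra.
- intros x hx; apply is_derive_lhs_flux; lra.
- intros x hx; apply is_derive_rhs_flux; lra.
- intros x hx; assert (h := hyp_ge_1 (1 / 4) (x ^ 2)).
  assert (1 <= hyp (1 / 4) (x ^ 2)) by (apply h; nra); lra.
- unfold rhs, prefactor.
  replace (0 ^ 2) with 0 by ring.
  replace (2 * 0 / (1 + 0)) with 0 by field.
  replace (1 / (1 + 0)) with 1 by field.
  rewrite !hyp_at_0, sqrt_1; ring.
Qed.
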